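(* Let $\Gamma_n=\{P_1,\ldots,P_k\}$ with $k\ge 2$ and let $Q$ be a minimal witness of $\Gamma_n$. Then $|Q|\le n(k-1)+1$.
   Context: $\Gamma_n$ is a set of $k$ pairwise non-isomorphic (unlabelled) posets each of size $n$. A downset is a downward-closed subset; $D_n(Q)$ is the set of downsets of $Q$ of size $n$ up to isomorphism. $Q$ is a witness of $\Gamma_n$ if $D_n(Q)=\Gamma_n$, and a minimal witness if no proper downset of $Q$ is a witness of $\Gamma_n$. *)

(* Defs.v *)
From mathcomp Require Import all_boot.
Set Implicit Arguments. Unset Strict Implicit. Unset Printing Implicit Defensive.

Definition is_poset (T : finType) (r : rel T) : Prop :=
  reflexive r /\ antisymmetric r /\ transitive r.

Definition is_downset_in (T : finType) (r : rel T) (S D : {set T}) : Prop :=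
  D \subset S /\ forall x y, x \in S -> y \in D -> r x y -> x \in D.

Definition sub_iso (T1 : finType) (r1 : rel T1) (A1 : {set T1})
                   (T2 : finType) (r2 : rel T2) (A2 : {set T2}) : Prop :=
  exists f : T1 -> T2,
    {in A1 &, injective f} /\ f @: A1 = A2 /\
    {in A1 &, forall x y, r2 (f x) (f y) = r1 x y}.

(* Gamma = {P_0, ..., P_(k-1)}, each P_i a poset on 'I_n.
   [witness_on r S n P] : the subposet S of (T, r) is a witness of Gamma,
   i.e. D_n(S) = Gamma (up to isomorphism). *)
Definition witness_on (T : finType) (r : rel T) (S : {set T})
    (n k : nat) (P : 'I_k -> rel 'I_n) : Prop :=
  (forall D : {set T}, is_downset_in r S D -> #|D| = n ->
      exists i : 'I_k, sub_iso r D (P i) setT) /\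
  (forall i : 'I_k, exists D : {set T},
      is_downset_in r S D /\ #|D| = n /\ sub_iso (P i) setT r D).

Definition is_witness (T : finType) (r : rel T) (n k : nat)
    (P : 'I_k -> rel 'I_n) : Prop :=
  witness_on r setT P.

Definition minimal_witness (T : finType) (r : rel T) (n k : nat)
    (P : 'I_k -> rel 'I_n) : Prop :=
  is_witness r P /\
  forall S : {set T}, S \proper setT -> is_downset_in r setT S ->
    ~ witness_on r S P.

(* Main.v *)
(* Among the realizations of the members of Gamma as n-downsets of Q, two of different types
   can be chosen to differ in a single point: exchanging a maximal point of D \ D' for a
   minimal point of D' \ D keeps a downset, and walking from D to D' this way must change
   type at some step. These two downsets together with one realization of each remaining
   member form a downset of size at most (n + 1) + (k - 2) n that is again a witness, so by
   minimality it is all of Q. *)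

Require Import Defs.
From mathcomp Require Import all_boot zify.
Set Implicit Arguments. Unset Strict Implicit. Unset Printing Implicit Defensive.

Section Extremal.

Variables (T : finType) (r : rel T).
Hypothesis r_poset : is_poset r.

Lemma exists_minimal_in (X : {set T}) (x0 : T) : x0 \in X ->
  exists2 b, b \in X & forall x, x \in X -> r x b -> x = b.
Proof.
have [r_refl [r_anti r_trans]] := r_poset.
move=> Xx0; case: (arg_minnP (fun b => #|[set y | r y b]|) Xx0) => b Xb b_min.
exists b => // x Xx rxb; apply/eqP; apply/negPn/negP => x_neq_b.
have : [set y | r y x] \proper [set y | r y b].
  apply/properP; split.
    by apply/subsetP => y; rewrite !inE => ryx; apply: r_trans ryx rxb.
  exists b; rewrite !inE ?r_refl //; apply/negP => rbx.
  by move/eqP: x_neq_b; apply; apply: r_anti; rewrite rxb rbx.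
by move/proper_card; rewrite ltnNge b_min.
Qed.

End Extremal.

Lemma is_poset_converse (T : finType) (r : rel T) :
  is_poset r -> is_poset (fun x y => r y x).
Proof.
case=> r_refl [r_anti r_trans]; split=> // ; split.
  by move=> x y /andP [rxy ryx]; apply: r_anti; rewrite rxy ryx.
by move=> x y z ryx rzy; apply: r_trans rzy ryx.
Qed.

Lemma exists_maximal_in (T : finType) (r : rel T) (X : {set T}) (x0 : T) :
  is_poset r -> x0 \in X ->
  exists2 b, b \in X & forall x, x \in X -> r b x -> x = b.
Proof. by move/is_poset_converse/exists_minimal_in; apply. Qed.

Lemma sub_iso_sym (T1 T2 : finType) (r1 : rel T1) (A1 : {set T1})
    (r2 : rel T2) (A2 : {set T2}) (x0 : T1) :
  sub_iso r1 A1 r2 A2 -> sub_iso r2 A2 r1 A1.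
Proof.
case=> f [f_inj [f_im f_rel]].
pose g y := odflt x0 [pick x in A1 | f x == y].
have gK y : y \in A2 -> g y \in A1 /\ f (g y) = y.
  rewrite -f_im => /imsetP [x A1x ->]; rewrite /g.
  case: pickP => [x' /andP [A1x' /eqP] // | /(_ x)].
  by rewrite A1x eqxx.
exists g; split; [|split].
- by move=> y1 y2 /gK [_ fgy1] /gK [_ fgy2] g_eq; rewrite -fgy1 -fgy2 g_eq.
- apply/setP => x; apply/imsetP/idP => [[y /gK [A1gy _] ->] // | A1x].
  have A2fx : f x \in A2 by rewrite -f_im imset_f.
  by exists (f x) => //; have [A1gfx fgfx] := gK _ A2fx; apply: f_inj.
- move=> y1 y2 /gK [A1gy1 fgy1] /gK [A1gy2 fgy2].
  by rewrite -f_rel // fgy1 fgy2.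
Qed.

Section Downsets.

Variables (T : finType) (r : rel T).

Local Notation downset D := (is_downset_in r setT D).

Lemma downsetU (D1 D2 : {set T}) : downset D1 -> downset D2 -> downset (D1 :|: D2).
Proof.
move=> [_ D1_down] [_ D2_down]; split=> [|x y _]; first exact: subsetT.
rewrite !inE => /orP [D1y | D2y] rxy; first by rewrite (D1_down x y).
by rewrite (D2_down x y) ?orbT.
Qed.

Lemma downset_bigcup (I : finType) (p : pred I) (F : I -> {set T}) :
  (forall i, p i -> downset (F i)) -> downset (\bigcup_(i | p i) F i).
Proof.
move=> F_down; split=> [|x y _]; first exact: subsetT.
case/bigcupP=> i pi Fiy rxy; apply/bigcupP; exists i => //.
by have [_ Fi_down] := F_down i pi; apply: Fi_down rxy.
Qed.

Lemma downset_in_subset (S D : {set T}) :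
  D \subset S -> downset D -> is_downset_in r S D.
Proof. by move=> DS [_ D_down]; split=> // x y _; apply: D_down. Qed.

Lemma downset_in_trans (S D : {set T}) :
  downset S -> is_downset_in r S D -> downset D.
Proof.
move=> [_ S_down] [DS D_down]; split=> [|x y _ Dy rxy]; first exact: subsetT.
by apply: (D_down x y) => //; apply: (S_down x y) => //; apply: (subsetP DS).
Qed.

Lemma downset_exchange (D D' : {set T}) (a b : T) :
  downset D -> downset D' ->
  a \in D :\: D' -> (forall x, x \in D :\: D' -> r a x -> x = a) ->
  b \in D' :\: D -> (forall x, x \in D' :\: D -> r x b -> x = b) ->
  downset (b |: (D :\ a)).
Proof.
move=> [_ D_down] [_ D'_down]; rewrite !inE => /andP [D'a Da] a_max.
move=> /andP [Db D'b] b_min; split=> [|x y _]; first exact: subsetT.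
rewrite !inE => /orP [/eqP -> | /andP [y_neq_a Dy]] rxy.
  have D'x := D'_down x b (in_setT x) D'b rxy.
  have [_ | Dx] := boolP (x \in D).
    by rewrite andbT; apply/orP; right; apply: contraNneq D'a => <-.
  by rewrite (b_min x) ?eqxx // !inE Dx D'x.
rewrite (D_down x y (in_setT x) Dy rxy) andbT; apply/orP; right.
apply: contra_neq y_neq_a => x_eq_a.
have ray : r a y by rewrite -x_eq_a.
apply: a_max ray; rewrite !inE Dy andbT; apply: contra D'a => D'y.
by rewrite -x_eq_a (D'_down x y (in_setT x) D'y rxy).
Qed.

Hypothesis r_poset : is_poset r.

Lemma exists_downset_closer (n : nat) (D D' : {set T}) :
  downset D -> downset D' -> #|D| = n -> #|D'| = n -> #|D :&: D'| < n ->
  exists D'' : {set T}, [/\ downset D'', #|D''| = n,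
    n.-1 <= #|D :&: D''| & #|D :&: D'| < #|D'' :&: D'|].
Proof.
move=> D_down D'_down cardD cardD' cardDD'.
have [a0 DD'a0] : exists a0, a0 \in D :\: D'.
  by apply/set0Pn; rewrite -card_gt0 cardsD; lia.
have [b0 D'Db0] : exists b0, b0 \in D' :\: D.
  by apply/set0Pn; rewrite -card_gt0 cardsD setIC; lia.
have [a DD'a a_max] := exists_maximal_in r_poset DD'a0.
have [b D'Db b_min] := exists_minimal_in r_poset D'Db0.
have /setDP [Da D'a] := DD'a; have /setDP [D'b Db] := D'Db.
exists (b |: (D :\ a)); split.
- exact: downset_exchange D'Db b_min.
- by rewrite cardsU1 !inE negb_and Db orbT /= (cardsD1 a D) Da in cardD *; lia.
- have DaD'' : D :\ a \subset D :&: (b |: (D :\ a)).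
    by apply/subsetP => x xDa; rewrite inE setU1r // (subsetP (subsetDl D [set a])).
  apply: leq_trans (subset_leq_card DaD'').
  by rewrite (cardsD1 a D) Da in cardD; lia.
- have DD'D'' : b |: (D :&: D') \subset (b |: (D :\ a)) :&: D'.
    apply/subsetP => x; rewrite !inE => /orP [/eqP -> | /andP [Dx D'x]].
      by rewrite eqxx D'b.
    by rewrite Dx D'x !andbT; apply/orP; right; apply: contraTneq D'x => ->.
  apply: leq_trans (subset_leq_card DD'D''); rewrite cardsU1 inE.
  by rewrite (negbTE Db).
Qed.

End Downsets.

Lemma card_bigcup_leq (I T : finType) (p : pred I) (F : I -> {set T}) :
  #|\bigcup_(i | p i) F i| <= \sum_(i | p i) #|F i|.
Proof.
apply: (big_ind2 (fun (A : {set T}) m => #|A| <= m)) => [|A m B m' leAm leBm|//].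
  by rewrite cards0.
by apply: leq_trans (leq_card_setU A B) _; apply: leq_add.
Qed.

Section Realizations.

Variables (n k : nat) (P : 'I_k -> rel 'I_n) (T : finType) (r : rel T).

Local Notation downset D := (is_downset_in r setT D).

Definition realizes (i : 'I_k) (D : {set T}) : Prop :=
  downset D /\ #|D| = n /\ sub_iso (P i) setT r D.

Hypothesis downset_typed : forall D : {set T}, downset D -> #|D| = n ->
  exists i : 'I_k, sub_iso r D (P i) setT.

Lemma witness_on_downset (S : {set T}) : downset S ->
  (forall i, exists2 D : {set T}, D \subset S & realizes i D) -> witness_on r S P.
Proof.
move=> S_down S_realizes; split=> [D D_down_in_S cardD | i].
  exact: downset_typed (downset_in_trans S_down D_down_in_S) cardD.
have [D DS [D_down [cardD Di]]] := S_realizes i.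
by exists D; split; first exact: downset_in_subset.
Qed.

Hypothesis r_poset : is_poset r.

(* Repeatedly exchange points of D towards D'; each new downset differs from the previous
   one in a single point, so the first change of type yields the adjacent pair. *)
Lemma exists_adjacent_realizations (i j : 'I_k) (D D' : {set T}) :
  i != j -> realizes i D -> realizes j D' ->
  exists i' j' : 'I_k, exists E E' : {set T},
    [/\ i' != j', realizes i' E, realizes j' E' & n.-1 <= #|E :&: E'|].
Proof.
have [m] := ubnP (n - #|D :&: D'|); elim: m => // m IHm in i D *.
move=> far_m ij [D_down [cardD Di]] D'j; have [D'_down [cardD' _]] := D'j.
have [close | far] := leqP n.-1 #|D :&: D'|; first by exists i, j, D, D'.
have [|D'' [D''_down cardD'' closeD farD'']] :=
  exists_downset_closer r_poset D_down D'_down cardD cardD'; first by lia.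
have [x0 _] : exists x, x \in D'' by apply/set0Pn; rewrite -card_gt0; lia.
have [l D''l] := downset_typed D''_down cardD''.
have D''_real : realizes l D'' by do !split=> //; apply: sub_iso_sym x0 D''l.
have [li | li] := eqVneq l i.
  by rewrite li in D''_real; apply: IHm D''_real D'j => //; lia.
by exists i, l, D, D''; split; rewrite // eq_sym.
Qed.

Lemma witness_on_patch (R : 'I_k -> {set T}) (i j : 'I_k) (E E' : {set T}) :
  (forall l, realizes l (R l)) -> realizes i E -> realizes j E' ->
  let S := E :|: E' :|: \bigcup_(l | (l != i) && (l != j)) R l in
  downset S /\ witness_on r S P.
Proof.
move=> R_real Ei E'j S.
have S_down : downset S.
  apply/downsetU/downset_bigcup => [|l _]; last by case: (R_real l).
  by apply: downsetU; [case: Ei | case: E'j].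
split=> //; apply: (witness_on_downset S_down) => l.
have [-> | li] := eqVneq l i; first by exists E; rewrite // /S -setUA subsetUl.
have [-> | lj] := eqVneq l j; first by exists E'; rewrite // /S -setUA setUCA subsetUl.
exists (R l) => //; apply: subset_trans (subsetUr _ _).
by apply: bigcup_sup; rewrite li lj.
Qed.

End Realizations.

Theorem mainTheorem11 (n k : nat) (P : 'I_k -> rel 'I_n)
  (HP : forall i, is_poset (P i))
  (Hk : 2 <= k)
  (Hniso : forall i j : 'I_k, i != j -> ~ sub_iso (P i) setT (P j) setT)
  (T : finType) (r : rel T) (HQ : is_poset r)
  (Hmin : minimal_witness r P) :
  #|T| <= n * (k - 1) + 1.
Proof.
case: Hmin => [[typed realized] minimal].
have [R R_real] := fin_all_exists realized.
have i0_neq_i1 : Ordinal (ltnW Hk) != Ordinal Hk by [].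
have [i [j [E [E' [ij Ei E'j closeEE']]]]] :=
  exists_adjacent_realizations typed HQ i0_neq_i1 (R_real _) (R_real _).
set U := \bigcup_(l | (l != i) && (l != j)) R l.
have [S_down S_witness] := witness_on_patch typed R_real Ei E'j.
have S_full : E :|: E' :|: U = setT.
  by apply/eqP/negPn/negP => S_ne; apply: (minimal _ _ S_down S_witness); rewrite properT.
have cardEE' : #|E :|: E'| <= n.+1.
  by move: Ei E'j => [_ [cardE _]] [_ [cardE' _]]; rewrite cardsU; lia.
have cardU : #|U| <= \sum_(l | (l != i) && (l != j)) n.
  apply: leq_trans (card_bigcup_leq _ _) _.
  by apply: leq_sum => l _; case: (R_real l) => _ [-> _].
have : \sum_(l < k) n = n + (n + \sum_(l | (l != i) && (l != j)) n).
  by rewrite (bigD1 i) //= (bigD1 j) //= eq_sym.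
rewrite sum_nat_const card_ord -cardsT -S_full.
have : #|E :|: E' :|: U| <= #|E :|: E'| + #|U| by apply: leq_card_setU.
lia.
Qed.
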